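(* Let $H\in(0,\tfrac12)$, $x_0,a,\sigma>0$, let $X^H=\{X^H(t),\ t\ge 0\}$ be the rough Bessel process and let $L^H=\{L^H(t),\ t\ge 0\}$ be the associated process $$L^H(t)=\lim_{\varepsilon\downarrow 0}\int_0^t \frac{1}{X^H_\varepsilon(s)\mathbf 1_{\{X^H_\varepsilon(s)>0\}}+\varepsilon}\,ds,\qquad t\ge 0.$$ Then, with probability 1: (1) the process $L^H$ is non-decreasing in $t$; (2) the processes $X^H$ and $L^H$ have continuous paths on $[0,\infty)$.
   Context: $B^H=\{B^H(t),\ t\ge0\}$ is a fractional Brownian motion with Hurst index $H\in(0,\frac12)$: a centered Gaussian process with $\mathbb E[B^H(t)B^H(s)]=\frac12(t^{2H}+s^{2H}-|t-s|^{2H})$, always taken in its modification with paths locally Hölder continuous of every order $\lambda\in(0,H)$. For constants $x_0,a,\sigma>0$ and each $\varepsilon>0$, $X^H_\varepsilon$ is the unique pathwise solution of $$X^H_\varepsilon(t)=x_0+\int_0^t\frac{a}{X^H_\varepsilon(s)\mathbf 1_{\{X^H_\varepsilon(s)>0\}}+\varepsilon}\,ds+\sigma B^H(t),\qquad t\ge0.$$ For $\varepsilon_1<\varepsilon_2$ one has $X^H_{\varepsilon_1}(t)\ge X^H_{\varepsilon_2}(t)$ for all $t$, so the pointwise limit $X^H(t):=\lim_{\varepsilon\downarrow0}X^H_\varepsilon(t)$ exists; it is called the rough (fractional) Bessel process. With probability 1, $X^H(t)<\infty$ and $X^H(t)\ge0$ for all $t\ge0$, and $X^H(t)>0$ for almost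 all $t\ge0$. Consequently the limit defining $L^H(t)$ exists and is finite, and $X^H(t)=x_0+aL^H(t)+\sigma B^H(t)$ for all $t\ge 0$. *)

(* Defs.v *)
From HB Require Import structures.
From mathcomp Require Import all_boot all_order all_algebra.
From mathcomp Require Import all_classical all_reals all_analysis.
Set Implicit Arguments.
Unset Strict Implicit.
Unset Printing Implicit Defensive.
Import Order.TTheory GRing.Theory Num.Theory.
Import numFieldNormedType.Exports.
Local Open Scope classical_set_scope.
Local Open Scope ring_scope.

(* Processes indexed by [0, +oo) are families indexed by R of which only the
   values at t >= 0 are ever constrained or used. *)

(* Pitfall: [normal_prob m 0] is the uniform law on [0, 1] in the library, so
   the degenerate case is the Dirac mass.  [s] is the standard deviation. *)
Definition gaussian_law (R : realType) (m s : R) (A : set R) : \bar R :=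
  if s == 0 then \d_m A else normal_prob m s A.

Definition gaussian_process (d : measure_display) (T : measurableType d)
    (R : realType) (P : probability T R) (B : R -> {RV P >-> R}) : Prop :=
  forall (n : nat) (t c : 'I_n -> R), (forall i, 0 <= t i) ->
  exists m s : R, 0 <= s /\ forall A : set R, measurable A ->
    P ((fun w => \sum_(i < n) c i * B (t i) w) @^-1` A) = gaussian_law m s A.

Definition locally_hoelder (R : realType) (lambda : R) (f : R -> R) : Prop :=
  forall b : R, 0 < b -> exists C : R, forall s t : R,
    0 <= s <= b -> 0 <= t <= b -> `|f t - f s| <= C * `|t - s| `^ lambda.

(* Fractional Brownian motion with Hurst index H, in its locally Hoelder
   continuous modification. *)
Record fractional_brownian_motion (d : measure_display) (T : measurableType d)
    (R : realType) (P : probability T R) (H : R) (B : R -> {RV P >-> R}) :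
    Prop := FractionalBrownianMotion {
  fbm_gaussian : gaussian_process B ;
  fbm_centered : forall t, 0 <= t -> ('E_P[B t] = 0)%E ;
  fbm_covariance : forall s t, 0 <= s -> 0 <= t ->
    ('E_P[(fun w => B t w * B s w)%R] =
     ((t `^ (2 * H) + s `^ (2 * H) - `|t - s| `^ (2 * H)) / 2)%:E)%E ;
  fbm_hoelder : forall (w : T) (lambda : R), 0 < lambda < H ->
    locally_hoelder lambda (fun t => B t w) }.

Definition reg_denominator (R : realType) (eps x : R) : R :=
  x * \1_[set y : R | 0 < y] x + eps.

(* [Y] is a (continuous) solution on [0, +oo) of the regularized equation
   driven by the path [b]. *)
Definition solves_regularized (R : realType) (x0 a sigma eps : R)
    (b Y : R -> R) : Prop :=
  {within `[0, +oo[, continuous Y} /\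
  forall t, 0 <= t ->
    Y t = x0 + \int[lebesgue_measure]_(s in `[0, t])
                  (a / reg_denominator eps (Y s)) + sigma * b t.

(* The monotone limits defining the two processes below exist in \bar R on
   every path; their finiteness is not part of the definitions. *)
Definition rough_bessel (R : realType) (T : Type) (Xe : R -> R -> T -> R)
    (X : R -> T -> \bar R) : Prop :=
  forall (t : R) (w : T), 0 <= t ->
    (Xe eps t w)%:E @[eps --> 0^'+] --> X t w.

Definition rough_bessel_drift (R : realType) (T : Type)
    (Xe : R -> R -> T -> R) (L : R -> T -> \bar R) : Prop :=
  forall (t : R) (w : T), 0 <= t ->
    (\int[lebesgue_measure]_(s in `[0, t])
       (1 / reg_denominator eps (Xe eps s w)))%:E @[eps --> 0^'+] --> L t w.

Definition nondecreasing_path (R : realType) (f : R -> \bar R) : Prop :=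
  forall s t : R, 0 <= s -> s <= t -> (f s <= f t)%E.

Definition continuous_path (R : realType) (f : R -> \bar R) : Prop :=
  (forall t, 0 <= t -> f t \is a fin_num) /\
  {within `[0, +oo[, continuous (fun t => fine (f t))}.

(* Main.v *)
(* The argument is pathwise.  A solution of the regularized equation that stays
   above [c > 0] has drift at most [a / c], so looking at its last passage at a
   level controls its rise over a short interval uniformly in [eps].  The same
   device gives monotonicity in [eps], so the limit [x] is a pointwise supremum
   of continuous functions.  It is finite, and nonnegative because a negative
   value would force a drift of order [1 / eps].  Continuity of [x] then has
   three sources: [x - sigma b] is nondecreasing, which bounds [x] from below
   on the right and from above on the left; a supremum of continuous functions
   is lower semicontinuous; and the uniform rise bound, started from
   [x t + e / 4 > 0], bounds [x] from above on the right.  Probability enters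
   only through [B 0 = 0] almost surely, which makes [x 0] nonnegative. *)
Require Import Defs.
From HB Require Import structures.
From mathcomp Require Import all_boot all_order all_algebra.
From mathcomp Require Import all_classical all_reals all_analysis.
From mathcomp Require Import measurable_realfun ring lra.
Set Implicit Arguments.
Unset Strict Implicit.
Unset Printing Implicit Defensive.
Import Order.TTheory GRing.Theory Num.Theory.
Import numFieldNormedType.Exports.
Local Open Scope classical_set_scope.
Local Open Scope ring_scope.

(** * Continuity on the half-line and last passage times *)

Lemma within_continuous_itvcyP (R : realType) (f : R -> R) :
  {within `[0, +oo[, continuous f} <->
  forall t e : R, 0 <= t -> 0 < e ->
    exists2 d : R, 0 < d & forall s, 0 <= s -> `|s - t| < d -> `|f s - f t| < e.
Proof.
rewrite subspace_continuousP; split=> [fc t e t0 e0|fc t /=].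
  have /fc/cvgrPdist_lt/(_ e e0) : `[0, +oo[%classic t by rewrite /= in_itv/= t0.
  rewrite near_withinE => /nbhs_ballP[d /= d0 dP]; exists d => // s s0 std.
  by rewrite distrC; apply: dP; rewrite /ball/= 1?distrC// in_itv/= s0.
rewrite in_itv/= andbT => t0; apply/cvgrPdist_lt => e e0.
have [d d0 dP] := fc t e t0 e0.
rewrite near_withinE; apply/nbhs_ballP; exists d => //= s std.
rewrite in_itv/= andbT => s0; rewrite distrC; apply: dP => //.
by rewrite distrC.
Qed.

(** [tau] is the supremum of the times in [[t, s]] at which [g <= c]. Continuity gives [g tau <= c],
    and [c < g s] then forces [tau < s]. *)
Lemma last_passage (R : realType) (g : R -> R) (c t s : R) :
  0 <= t -> t <= s -> {within `[0, +oo[, continuous g} ->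
  g t <= c -> c < g s ->
  exists tau, [/\ t <= tau, tau < s, g tau <= c &
    forall u, tau < u -> u <= s -> c < g u].
Proof.
move=> t0 ts /within_continuous_itvcyP gc gtc cgs.
pose A := [set u | t <= u <= s /\ g u <= c].
have At : A t by split; rewrite ?lexx.
have supA : has_sup A.
  by split; [exists t | exists s => u [/andP[]]].
have ttau : t <= sup A by apply: ub_le_sup => //; case: supA.
have taus : sup A <= s by apply: ge_sup; [exists t | move=> u [/andP[]]].
have tau0 : 0 <= sup A by exact: le_trans ttau.
have gtau : g (sup A) <= c.
  rewrite leNgt; apply/negP => cg.
  have [d d0 dP] := gc (sup A) (g (sup A) - c) tau0 ltac:(by rewrite subr_gt0).
  have [u [/andP[tu us] guc] du] := sup_adherent d0 supA.
  have uA : u <= sup A.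
    by apply: ub_le_sup; [case: supA | split; rewrite ?tu].
  have : `|g u - g (sup A)| < g (sup A) - c.
    apply: dP; first exact: le_trans tu.
    by rewrite ler0_norm ?subr_le0//; lra.
  by rewrite ltr_norml; lra.
exists (sup A); split => //.
  rewrite lt_neqAle taus andbT; apply/eqP => e.
  by rewrite e leNgt cgs in gtau.
move=> u tauu us; rewrite ltNge; apply/negP => guc.
suff : u <= sup A by rewrite leNgt tauu.
apply: ub_le_sup; first by case: supA.
by split => //; rewrite us (le_trans ttau (ltW tauu)).
Qed.

(** * The regularized equation along a fixed driving path *)

Section regularized.
Context (R : realType).
Implicit Types (a sigma eps : R) (b Y : R -> R).

(** The [max] form makes continuity and monotonicity in [x] visible. *)
Lemma reg_denominatorE eps x : reg_denominator eps x = Num.max x 0 + eps.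
Proof.
rewrite /reg_denominator indicE; have [x0|x0] := ltP 0 x.
  by rewrite mem_set//= mulr1.
by rewrite memNset ?mulr0//=; apply/negP; rewrite -leNgt.
Qed.

Lemma reg_denominator_gt0 eps x : 0 < eps -> 0 < reg_denominator eps x.
Proof. by move=> e0; rewrite reg_denominatorE ltr_wpDl// le_max lexx orbT. Qed.

Lemma reg_drift_integrable a eps Y s t : 0 < eps -> 0 <= s ->
  {within `[0, +oo[, continuous Y} ->
  lebesgue_measure.-integrable `[s, t]
    (EFin \o (fun u => a / reg_denominator eps (Y u))).
Proof.
move=> e0 s0 Yc; apply: continuous_compact_integrable.
  exact: segment_compact.
suff : {within `[0, +oo[, continuous (fun u => a / (Num.max (Y u) 0 + eps))}.
  rewrite (_ : (fun u => a / reg_denominator eps (Y u)) =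
    (fun u => a / (Num.max (Y u) 0 + eps))); last first.
    by apply/funext => u; rewrite reg_denominatorE.
  apply: continuous_subspaceW => u /=.
  by rewrite !in_itv/= andbT => /andP[su _]; exact: le_trans su.
move=> u; apply: cvgM; first exact: cvg_cst.
apply: cvgV; first by rewrite gt_eqF// -reg_denominatorE reg_denominator_gt0.
apply: cvgD; last exact: cvg_cst.
have maxc : {within `[0, +oo[, continuous (Y \max cst 0)}.
  by move=> v; apply: max_fun_continuous => // w; exact: cvg_cst.
exact: maxc.
Qed.

(** The interval is open at [s] because, after a last passage time, bounds on [Y] hold only strictly
    later. *)
Lemma regularized_increment (x0 : R) a sigma eps b Y s t : 0 < eps ->
  solves_regularized x0 a sigma eps b Y -> 0 <= s -> s <= t ->
  Y t - Y s = \int[lebesgue_measure]_(u in `]s, t])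
                (a / reg_denominator eps (Y u)) + sigma * (b t - b s).
Proof.
move=> e0 [Yc YE] s0 st.
have t0 : 0 <= t by exact: le_trans st.
have := @Rintegral_itvB _ (fun u => a / reg_denominator eps (Y u))
  (BLeft 0) (BRight t) s (reg_drift_integrable a t e0 (lexx 0) Yc).
rewrite !bnd_simp => /(_ s0 st) <-.
by rewrite (YE t)// (YE s)//; ring.
Qed.

(** After the last time with [Y2 <= Y1], the larger value and the larger [eps2] both make the drift
    of [Y2] the smaller one, and the noise cancels. So [Y2 - Y1] cannot have become positive. *)
Lemma regularized_comparison (x0 : R) a sigma eps1 eps2 b Y1 Y2 t : 0 < a ->
  0 < eps1 -> eps1 <= eps2 -> 0 <= t ->
  solves_regularized x0 a sigma eps1 b Y1 ->
  solves_regularized x0 a sigma eps2 b Y2 -> Y2 t <= Y1 t.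
Proof.
move=> a0 e10 e12 t0 sol1 sol2; have e20 := lt_le_trans e10 e12.
have [Y1c Y1E] := sol1; have [Y2c Y2E] := sol2.
rewrite leNgt; apply/negP => Y12.
have D0 : Y2 0 - Y1 0 <= 0.
  by rewrite Y1E ?Y2E// set_itv1 !Rintegral_set1 subrr.
have Dc : {within `[0, +oo[, continuous (fun u => Y2 u - Y1 u)}.
  by move=> u; apply: cvgB; [exact: Y2c | exact: Y1c].
have [|tau [tau0 taut Dtau Dpos]] := last_passage (lexx 0) t0 Dc D0 (s := t).
  by rewrite subr_gt0.
suff : Y2 t - Y2 tau <= Y1 t - Y1 tau by lra.
rewrite (regularized_increment e10 sol1 tau0 (ltW taut)).
rewrite (regularized_increment e20 sol2 tau0 (ltW taut)) lerD2r.
apply: le_Rintegral => //.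
- apply: integrableS (reg_drift_integrable a _ e20 tau0 Y2c) => //.
  by apply: subset_itvr; rewrite bnd_simp.
- apply: integrableS (reg_drift_integrable a _ e10 tau0 Y1c) => //.
  by apply: subset_itvr; rewrite bnd_simp.
move=> u; rewrite /= in_itv/= => /andP[tauu ut].
rewrite ler_wpM2l ?(ltW a0)// lef_pV2 ?posrE ?reg_denominator_gt0//.
rewrite !reg_denominatorE lerD// ge_max !le_max lexx orbT andbT.
by have := Dpos u tauu ut; rewrite subr_gt0 => /ltW ->.
Qed.

Lemma regularized_increment_ge (x0 : R) a sigma eps b Y s t : 0 < a ->
  0 < eps -> solves_regularized x0 a sigma eps b Y -> 0 <= s -> s <= t ->
  sigma * (b t - b s) <= Y t - Y s.
Proof.
move=> a0 e0 sol s0 st.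
rewrite (regularized_increment e0 sol s0 st) lerDr Rintegral_ge0// => u _.
by rewrite divr_ge0 ?ltW ?reg_denominator_gt0.
Qed.

Lemma regularized_increment_le (x0 : R) a sigma eps b Y c s t : 0 < a ->
  0 < c -> 0 < eps -> solves_regularized x0 a sigma eps b Y ->
  0 <= s -> s <= t -> (forall u, s < u -> u <= t -> c <= Y u) ->
  Y t - Y s <= a / c * (t - s) + sigma * (b t - b s).
Proof.
move=> a0 c0 e0 sol s0 st cY.
rewrite (regularized_increment e0 sol s0 st) lerD2r.
have <- : \int[lebesgue_measure]_(u in `]s, t]) (a / c) = a / c * (t - s).
  rewrite Rintegral_cst//= lebesgue_measure_itv/= lte_fin.
  have [//|ts] := ltP; have -> : t = s by lra.
  by rewrite subrr.
apply: le_Rintegral => //.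
- apply: integrableS (reg_drift_integrable a _ e0 s0 sol.1) => //.
  by apply: subset_itvr; rewrite bnd_simp.
- have : lebesgue_measure.-integrable `[s, t] (EFin \o (fun=> a / c)).
    apply: continuous_compact_integrable; first exact: segment_compact.
    by move=> u; exact: cvg_cst.
  by apply: integrableS => //; apply: subset_itvr; rewrite bnd_simp.
move=> u; rewrite /= in_itv/= => /andP[su ut].
rewrite ler_wpM2l ?(ltW a0)// lef_pV2 ?posrE ?reg_denominator_gt0//.
rewrite reg_denominatorE (le_trans (cY u su ut))//.
by rewrite ler_wpDr ?(ltW e0)// le_max lexx.
Qed.

(** At nonpositive values the denominator is exactly [eps], so the drift is constant. *)
Lemma regularized_increment_nonpos (x0 : R) a sigma eps b Y s t : 0 < a ->
  0 < eps -> solves_regularized x0 a sigma eps b Y ->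
  0 <= s -> s <= t -> (forall u, s < u -> u <= t -> Y u <= 0) ->
  a / eps * (t - s) + sigma * (b t - b s) <= Y t - Y s.
Proof.
move=> a0 e0 sol s0 st Y0.
rewrite (regularized_increment e0 sol s0 st) lerD2r.
rewrite (@eq_Rintegral _ _ _ _ _ (cst (a / eps))); last first.
  move=> u; rewrite inE /= in_itv/= => /andP[su ut].
  by rewrite reg_denominatorE max_r ?add0r ?Y0.
rewrite Rintegral_cst//= lebesgue_measure_itv/= lte_fin.
by have [//|ts] := ltP s t; rewrite (_ : t = s) ?subrr//; lra.
Qed.

(* After the last time the solution is at most [c], its drift is at most
   [a / c]. *)
Lemma regularized_le (x0 : R) a sigma eps b Y c M s t : 0 < a -> 0 < c ->
  0 < eps -> solves_regularized x0 a sigma eps b Y -> 0 <= s -> s <= t ->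
  Y s <= c -> 0 <= M ->
  (forall u, s <= u <= t -> sigma * (b t - b u) <= M) ->
  Y t <= c + a / c * (t - s) + M.
Proof.
move=> a0 c0 e0 sol s0 st Ysc M0 bM.
have ac : 0 < a / c by rewrite divr_gt0.
have [Ytc|cYt] := leP (Y t) c; first by nra.
have [tau [stau taut Ytau cY]] := last_passage s0 st sol.1 Ysc cYt.
have tau0 := le_trans s0 stau.
have := regularized_increment_le a0 c0 e0 sol tau0 (ltW taut)
  (fun u h1 h2 => ltW (cY u h1 h2)).
by have := bM tau; rewrite stau (ltW taut) => /(_ isT); nra.
Qed.

End regularized.

(** * Monotone limits as suprema *)

Lemma nonincreasing_at_right0_sup (R : realType) (f : R -> R) (l : \bar R) :
  (forall e1 e2, 0 < e1 -> e1 <= e2 -> f e2 <= f e1) ->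
  (f e)%:E @[e --> 0^'+] --> l ->
  (forall e, 0 < e -> ((f e)%:E <= l)%E) /\
  (forall M, (forall e, 0 < e -> ((f e)%:E <= M)%E) -> (l <= M)%E).
Proof.
move=> f_noninc fl; split=> [e e0|M fM].
  apply: cvge_ge fl; near=> e'; rewrite lee_fin; apply: f_noninc.
    by near: e'; exact: nbhs_right_gt.
  by near: e'; exact: nbhs_right_le.
apply: cvge_le fl; near=> e'; apply: fM.
by near: e'; exact: nbhs_right_gt.
Unshelve. all: by end_near. Qed.

Definition regularized_family (R : realType) (x0 a sigma : R) (b : R -> R)
    (Y : R -> R -> R) :=
  forall eps, 0 < eps -> solves_regularized x0 a sigma eps b (Y eps).

(** The least upper bound property replaces the limit: a bound on [Y eps t] uniform in [eps] passes
    directly to [x t]. *)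
Definition pointwise_sup (R : realType) (Y : R -> R -> R) (x : R -> R) :=
  forall t, 0 <= t -> (forall eps, 0 < eps -> Y eps t <= x t) /\
    (forall M, (forall eps, 0 < eps -> Y eps t <= M) -> x t <= M).

(** * Finiteness, sign and continuity of the limit path *)

Section bessel_path.
Context (R : realType) (x0 a sigma : R) (b : R -> R) (Y : R -> R -> R).

Lemma regularized_family_bounded (t : R) : 0 < a ->
  {within `[0, +oo[, continuous b} -> regularized_family x0 a sigma b Y -> 0 <= t ->
  exists M, forall eps, 0 < eps -> Y eps t <= M.
Proof.
move=> a0 bc sol t0.
have bc' : {within `[0, t], continuous (fun u => sigma * b u)}.
  have : {within `[0, +oo[, continuous (fun u => sigma * b u)}.
    by move=> u; apply: cvgM; [exact: cvg_cst | exact: bc].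
  apply: continuous_subspaceW => u /=.
  by rewrite !in_itv/= andbT => /andP[].
have [u0 _ u0min] := EVT_min t0 bc'.
(* A positive level above the common starting value of all [Y eps]; the minimum at [u0] bounds the
   noise, so nothing depends on [eps]. *)
pose c := `|x0 + sigma * b 0| + 1.
have c0 : 0 < c by rewrite ltr_wpDl.
exists (c + a / c * (t - 0) + `|sigma * b t - sigma * b u0|) => eps e0.
apply: regularized_le (sol eps e0) _ _ _ _ _ => //.
  rewrite (sol eps e0).2// set_itv1 Rintegral_set1 addr0.
  by rewrite (le_trans (ler_norm _))// lerDl.
move=> u ut; rewrite mulrBr.
by apply: le_trans (ler_norm _); rewrite lerB// u0min// in_itv.
Qed.


(** [Y eps s] is at most [Y eps t], hence at most [x t], minus the noise increment; then take the
    supremum over [eps] at time [s]. *)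
Lemma bessel_path_increment_ge (x : R -> R) (s t : R) : 0 < a ->
  regularized_family x0 a sigma b Y -> pointwise_sup Y x ->
  0 <= s -> s <= t -> sigma * (b t - b s) <= x t - x s.
Proof.
move=> a0 sol supx s0 st; have t0 := le_trans s0 st.
suff : x s <= x t - sigma * (b t - b s) by lra.
apply: (supx s s0).2 => eps e0.
have := regularized_increment_ge a0 e0 (sol eps e0) s0 st.
by have := (supx t t0).1 eps e0; lra.
Qed.

Lemma scaled_path_modulus : {within `[0, +oo[, continuous b} ->
  forall t e : R, 0 <= t -> 0 < e -> exists2 d : R, 0 < d &
    forall s, 0 <= s -> `|s - t| < d -> `|sigma * (b s - b t)| < e.
Proof.
move=> bc t e t0 e0.
have /within_continuous_itvcyP/(_ t e t0 e0)[d d0 dP] :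
    {within `[0, +oo[, continuous (fun u => sigma * b u)}.
  by move=> u; apply: cvgM; [exact: cvg_cst | exact: bc].
by exists d => // s s0 std; rewrite mulrBr; exact: dP.
Qed.

(* Where the limit is negative, every approximation is nonpositive on a common
   interval to the left, and its drift there is of order [a / eps]. *)
Lemma bessel_path_ge0 (x : R -> R) (t : R) : 0 < a ->
  {within `[0, +oo[, continuous b} -> regularized_family x0 a sigma b Y ->
  pointwise_sup Y x -> 0 <= x0 + sigma * b 0 -> 0 <= t -> 0 <= x t.
Proof.
move=> a0 bc sol supx start; rewrite le_eqVlt => /predU1P[<-|t0].
  apply: le_trans ((supx 0 (lexx 0)).1 1 ltr01).
  by rewrite (sol 1 ltr01).2// set_itv1 Rintegral_set1 addr0.
rewrite leNgt; apply/negP => xt0.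
have [d d0 dP] := scaled_path_modulus bc (ltW t0)
  (e := - x t) ltac:(by rewrite oppr_gt0).
pose s := Num.max 0 (t - d / 2).
have s0 : 0 <= s by rewrite le_max lexx.
have st : s < t by rewrite gt_max t0/=; lra.
have sd : t - d / 2 <= s by rewrite le_max lexx orbT.
have ub eps : 0 < eps ->
    x0 + sigma * b t + a / eps * (t - s) <= x t.
  move=> e0; have sole := sol eps e0.
  (* The drift is nonnegative, so [Y eps u] exceeds [Y eps t <= x t] by at most the noise increment,
     which is below [- x t]. *)
  have Y0 u : s < u -> u <= t -> Y eps u <= 0.
    move=> su ut; have u0 := le_trans s0 (ltW su).
    have := regularized_increment_ge a0 e0 sole u0 ut.
    have := (supx t (ltW t0)).1 eps e0.
    have : `|sigma * (b u - b t)| < - x t.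
      by apply: dP => //; rewrite ler0_norm ?subr_le0//; lra.
    by rewrite ltr_norml => /andP[]; lra.
  have := regularized_increment_nonpos a0 e0 sole s0 (ltW st) Y0.
  have := regularized_increment_ge a0 e0 sole (lexx 0) s0.
  have := (supx t (ltW t0)).1 eps e0.
  have : Y eps 0 = x0 + sigma * b 0.
    by rewrite sole.2// set_itv1 Rintegral_set1 addr0.
  by rewrite !mulrBr; lra.
pose K := x0 + sigma * b t.
have ts0 : 0 < t - s by rewrite subr_gt0.
have K0 : 0 < `|K| + 1 by rewrite ltr_wpDl.
(* For this [eps] the drift over [[s, t]] is [|K| + 1], so [ub] would make [x t] positive. *)
have e0 : 0 < a * (t - s) / (`|K| + 1) by rewrite divr_gt0// mulr_gt0.
have := ub _ e0; rewrite -/K.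
have -> : a / (a * (t - s) / (`|K| + 1)) * (t - s) = `|K| + 1.
  by field; rewrite ?gt_eqF.
have := ler_norm (- K); rewrite normrN; lra.
Qed.

Lemma bessel_path_continuous (x : R -> R) : 0 < a ->
  {within `[0, +oo[, continuous b} -> regularized_family x0 a sigma b Y ->
  pointwise_sup Y x -> 0 <= x0 + sigma * b 0 ->
  {within `[0, +oo[, continuous x}.
Proof.
move=> a0 bc sol supx start; apply/within_continuous_itvcyP => t e t0 e0.
have xt0 := bessel_path_ge0 a0 bc sol supx start t0.
have e8 : 0 < e / 8 by lra.
have [d1 d10 d1P] := scaled_path_modulus bc t0 e8.
(* Positive since [x t >= 0], and above [Y eps t] for every [eps]. The radius [d2] keeps the rise
   [a / c * (s - t)] below [e / 4]. *)
pose c := x t + e / 4.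
have c0 : 0 < c by rewrite /c; lra.
have ac0 : 0 < a / c by rewrite divr_gt0.
pose d2 := e / 4 / (a / c).
have d20 : 0 < d2 by rewrite divr_gt0//; lra.
(* One approximation nearly attains the supremum at [t]; its continuity bounds [x] from below near
   [t]. *)
have [eps e'0 Yeps] : exists2 eps, 0 < eps & x t - e / 4 < Y eps t.
  apply: contrapT => nY.
  suff : x t <= x t - e / 4 by lra.
  apply: (supx t t0).2 => eps e'0; rewrite leNgt; apply/negP => Yt.
  by apply: nY; exists eps.
have e4 : 0 < e / 4 by lra.
have [d3 d30 d3P] := (within_continuous_itvcyP _).1 (sol eps e'0).1 t _ t0 e4.
exists (Num.min d1 (Num.min d2 d3)); first by rewrite !lt_min d10 d20.
move=> s s0; rewrite !lt_min => /and3P[sd1 sd2 sd3].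
have := d1P s s0 sd1; rewrite ltr_norml => /andP[bs1 bs2].
have [st|ts] := leP s t.
  have := bessel_path_increment_ge a0 sol supx s0 st.
  have := (supx s s0).1 eps e'0.
  have := d3P s s0 sd3; rewrite !ltr_norml => /andP[Ys1 Ys2].
  by rewrite !mulrBr in bs1 bs2 * => *; apply/andP; split; lra.
have := bessel_path_increment_ge a0 sol supx t0 (ltW ts) => lo.
(* The last [e / 4] covers the noise between [u] and [s]: each is within [e / 8] of the noise at
   [t]. *)
have hi : x s <= c + a / c * (s - t) + e / 4.
  apply: (supx s s0).2 => eps' e''0.
  apply: (regularized_le a0 c0 e''0 (sol eps' e''0)) => //.
  - exact: ltW.
  - by have := (supx t t0).1 eps' e''0; rewrite /c; lra.
  - exact: ltW.
  - move=> u /andP[tu us].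
    have u0 := le_trans t0 tu.
    have : `|sigma * (b u - b t)| < e / 8.
      apply: d1P => //; apply: le_lt_trans sd1.
      by rewrite !ger0_norm ?subr_ge0 ?(ltW ts)// lerB.
    by rewrite ltr_norml !mulrBr in bs1 bs2 * => /andP[]; lra.
have : a / c * (s - t) < e / 4.
  rewrite mulrC -ltr_pdivlMr//.
  by move: sd2; rewrite gtr0_norm ?subr_gt0.
by rewrite ltr_norml; rewrite /c in hi *; lra.
Qed.

End bessel_path.

(** * Path continuity and starting value of the driving noise *)

Lemma locally_hoelder_continuous (R : realType) (lambda : R) (f : R -> R) :
  0 < lambda -> locally_hoelder lambda f -> {within `[0, +oo[, continuous f}.
Proof.
move=> l0 fh; apply/within_continuous_itvcyP => t e t0 e0.
have [C fC] := fh (t + 1) ltac:(by rewrite ltr_wpDl).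
have C0 : 0 < `|C| + 1 by rewrite ltr_wpDl.
have eC0 : 0 < e / (`|C| + 1) by rewrite divr_gt0.
(* The bound 1 keeps [s] within the horizon [t + 1]; the other solves [(|C| + 1) * r ^ lambda = e],
   with [|C| + 1] because [C] may be nonpositive. *)
exists (Num.min 1 ((e / (`|C| + 1)) `^ lambda^-1)).
  by rewrite lt_min ltr01 powR_gt0.
move=> s s0; rewrite lt_min => /andP[st1 st].
have st' : s <= t + 1 by move: st1; rewrite ltr_norml => /andP[_]; lra.
have := fC t s; rewrite t0 s0 st' lerDl ler01 => /(_ isT isT) /le_lt_trans.
apply; have : `|s - t| `^ lambda < e / (`|C| + 1).
  have := gt0_ltr_powR l0 _ _ st; rewrite -powRrM mulVf ?gt_eqF// powRr1 ?ltW//.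
  by apply; rewrite nnegrE// powR_ge0.
rewrite ltr_pdivlMr// mulrC => /(le_lt_trans _); apply.
rewrite ler_wpM2r ?powR_ge0//.
by rewrite (le_trans (ler_norm _))// lerDl.
Qed.

(** The covariance at [s = t = 0] says that the nonnegative variable [B 0 ^ 2] has mean zero. *)
Lemma fbm_start (d : measure_display) (T : measurableType d) (R : realType)
    (P : probability T R) (H : R) (B : R -> {RV P >-> R}) : 0 < H ->
  fractional_brownian_motion H B -> {ae P, forall w, B 0 w = 0}.
Proof.
move=> H0 hB.
have := fbm_covariance hB (lexx 0) (lexx 0).
(* The exponent must be nonzero here, since the power of 0 with exponent 0 is 1. *)
rewrite subrr normr0 powR0 ?mulf_neq0 ?gt_eqF// subr0 addr0 mul0r unlock => E0.
have mB2 : measurable_fun [set: T] (fun w => B 0 w * B 0 w).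
  exact: measurable_funM.
have [+ _] := ae_eq_integral_abs P measurableT
  ((measurable_EFinP _ _).2 mB2).
under eq_integral do rewrite gee0_abs ?lee_fin -?expr2 ?sqr_ge0//.
move=> /(_ E0); apply: filterS => w /(_ I)[] /eqP.
by rewrite mulf_eq0 orbb => /eqP.
Qed.

Theorem theorem2p5 (d : measure_display) (T : measurableType d)
    (R : realType) (P : probability T R) (H x0 a sigma : R)
    (B : R -> {RV P >-> R}) (Xe : R -> R -> T -> R) (X L : R -> T -> \bar R)
    (hH : 0 < H < 1 / 2) (hx0 : 0 < x0) (ha : 0 < a) (hsigma : 0 < sigma)
    (hB : fractional_brownian_motion H B)
    (hXe : forall (eps : R) (w : T), 0 < eps ->
       solves_regularized x0 a sigma eps
         (fun t => B t w) (fun t => Xe eps t w))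
    (hX : rough_bessel Xe X) (hL : rough_bessel_drift Xe L) :
  {ae P, forall w : T,
    nondecreasing_path (fun t => L t w) /\
    continuous_path (fun t => X t w) /\ continuous_path (fun t => L t w)}.
Proof.
have /andP[H0 _] := hH.
apply: filterS (fbm_start H0 hB) => w Bw0.
have bc : {within `[0, +oo[, continuous (fun t => B t w)}.
  apply: (@locally_hoelder_continuous _ (H / 2)); first by rewrite divr_gt0.
  by apply: fbm_hoelder hB _ _ _; apply/andP; split; lra.
have sol : regularized_family x0 a sigma (fun t => B t w)
    (fun eps t => Xe eps t w) by move=> eps; exact: hXe.
have supX t (t0 : 0 <= t) := nonincreasing_at_right0_sup
  (fun e1 e2 e10 e12 => regularized_comparison ha e10 e12 t0 (sol e1 e10)
    (sol e2 (lt_le_trans e10 e12))) (hX t w t0).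
(* Bounded below by the approximation with [eps = 1], above by the bound uniform in [eps]. *)
have Xfin t : 0 <= t -> X t w \is a fin_num.
  move=> t0; have [M XM] := regularized_family_bounded ha bc sol t0.
  apply/fin_numPlt; apply/andP; split.
    by apply: lt_le_trans ((supX t t0).1 1 ltr01); rewrite ltNyr.
  apply: (@le_lt_trans _ _ M%:E); last by rewrite ltry.
  by apply: (supX t t0).2 => eps e0; rewrite lee_fin XM.
pose x t := fine (X t w).
have xE t : 0 <= t -> X t w = (x t)%:E by move=> t0; rewrite fineK// Xfin.
have supx : pointwise_sup (fun eps t => Xe eps t w) x.
  move=> t t0; have [] := supX t t0; rewrite xE// => ub lub.
  split=> [eps e0|M XM]; first by rewrite -lee_fin ub.
  by rewrite -lee_fin lub// => eps e0; rewrite lee_fin XM.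
have start : 0 <= x0 + sigma * B 0 w by rewrite Bw0 mulr0 addr0 ltW.
have xc := bessel_path_continuous ha bc sol supx start.
(* The equation solved for its integral expresses the drift through [Xe eps t w], so both limits
   determine each other. Monotonicity and continuity of [L] are then read off from [x]. *)
have LE t : 0 <= t -> L t w = ((x t - x0 - sigma * B t w) / a)%:E.
  move=> t0; apply: cvg_unique (hL t w t0) _ => //.
  have : (Xe eps t w)%:E @[eps --> 0^'+] --> (x t)%:E.
    by rewrite -xE//; exact: hX.
  move=> /fine_cvg/= Xx.
  have : ((Xe eps t w - x0 - sigma * B t w) / a)%:E @[eps --> 0^'+] -->
      ((x t - x0 - sigma * B t w) / a)%:E.
    apply: cvg_EFin; first exact: nearW.
    apply: cvgM; last exact: cvg_cst.
    by apply: cvgB; [apply: cvgB => //|]; exact: cvg_cst.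
  apply: cvg_trans; apply: near_eq_cvg; near=> eps.
  have e0 : 0 < eps by near: eps; exact: nbhs_right_gt.
  congr EFin; have [Yc YE] := sol eps e0.
  rewrite YE//.
  have -> : \int[lebesgue_measure]_(s in `[0, t])
        (a / reg_denominator eps (Xe eps s w)) =
      a * \int[lebesgue_measure]_(s in `[0, t])
        (1 / reg_denominator eps (Xe eps s w)).
    rewrite -RintegralZl//.
      by apply: eq_Rintegral => s _; rewrite mul1r.
    exact: (reg_drift_integrable 1 t e0 (lexx 0) Yc).
  by field; rewrite gt_eqF.
have Lfin t : 0 <= t -> L t w \is a fin_num by move=> t0; rewrite LE.
split=> [s t s0 st|].
  have t0 := le_trans s0 st.
  rewrite !LE// lee_fin ler_pM2r ?invr_gt0//.
  by have := bessel_path_increment_ge ha sol supx s0 st; rewrite mulrBr; lra.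
split; first by split.
(* The formula [LE] holds only at nonnegative times, the only ones that this form of continuity
   mentions. *)
split=> //; apply/within_continuous_itvcyP => t e t0 e0.
have : {within `[0, +oo[, continuous
    (fun t => (x t - x0 - sigma * B t w) / a)}.
  move=> u; apply: cvgM; last exact: cvg_cst.
  apply: cvgB; first by apply: cvgB; [exact: xc | exact: cvg_cst].
  by apply: cvgM; [exact: cvg_cst | exact: bc].
move=> /within_continuous_itvcyP/(_ t e t0 e0)[d' d'0 dP].
by exists d' => // s s0 std; rewrite !LE//=; exact: dP.
Unshelve. all: by end_near. Qed.
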